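(* Let $M=(E,\mathcal{B})$ be a matroid of rank $r$ on $n:=|E|$ elements, and let $t\leq r$. Then $$\frac{\dim \mathcal{D}(M)}{\binom{n}{r}}\leq \frac{\max\{\dim \mathcal{D}(M/S): ~S\in \binom{E}{r-t}\text{ independent in }M\}}{\binom{n-r+t}{t}}.$$
   Context: For a matroid $M=(E,\mathcal{B})$ of rank $r$ and a function $\nu:\mathcal{B}\to\mathbb{R}$, let $\overline{\nu}:\binom{E}{r}\to\mathbb{R}\cup\{\infty\}$ be the extension of $\nu$ taking value $\infty$ outside $\mathcal{B}$. $\nu$ is a valuation of $M$ if for all $B,B'\in\binom{E}{r}$ and all $e\in B\setminus B'$ there is $f\in B'\setminus B$ with $\overline{\nu}(B)+\overline{\nu}(B')\geq\overline{\nu}(B-e+f)+\overline{\nu}(B'+e-f)$. The Dressian $\mathscr{D}(M)\subseteq\mathbb{R}^{\mathcal{B}}$ is the set of valuations of $M$. Let $Z(r,E)$ be the set of triples $(S,ab,cd)$ with $S\in\binom{E}{r-2}$ and $a,b,c,d\in E\setminus S$ distinct; write $Sab:=S\cup\{a,b\}$ etc. For a valuation $\nu$ put $[\overline{\nu}]:=\{(S,ab,cd)\in Z(r,E):\overline{\nu}(Sac)+\overline{\nu}(Sbd)=\overline{\nu}(Sad)+\overline{\nu}(Sbc)\}$. Two valuations $\nu,\nu'$ of $M$ are combinatorially equivalent, $\nu\sim\nu'$, if $[\overline{\nu}]=[\overline{\nu'}]$. For $\nu\in\mathscr{D}(M)$ let $D(\nu):=\{\nu'\in\mathbb{R}^{\mathcal{B}}:\nu'\sim\nu\}$.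 The fan $\mathcal{D}(M)$ is the collection of topological closures $\overline{D(\nu)}$, $\nu\in\mathscr{D}(M)$ (its ''cells''); $\dim\mathcal{D}(M)$ is the maximum dimension of a cell. For an independent set $S$ of $M$, $M/S$ is the contraction, the matroid on $E\setminus S$ with bases $\{B\setminus S: B\in\mathcal{B}, S\subseteq B\}$. *)

(* Defs.v *)
From HB Require Import structures.
From mathcomp Require Import all_boot all_order all_algebra.
From mathcomp Require Import all_classical all_reals all_analysis.

Set Implicit Arguments.
Unset Strict Implicit.
Unset Printing Implicit Defensive.

Import Order.TTheory GRing.Theory Num.Theory.
Import numFieldNormedType.Exports.

Local Open Scope ring_scope.

(** The ground set is a subset of an ambient finite type, so that a minor of a
    matroid is again a matroid over the same type. *)
Record matroid (T : finType) := Matroid {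
  ground : {set T};
  bases : {set {set T}};
  bases_neq0 : bases != finset.set0;
  bases_ground : forall B, B \in bases -> B \subset ground;
  basis_exchange : forall B B', B \in bases -> B' \in bases ->
    forall e, e \in B :\: B' ->
    exists2 f, f \in B' :\: B & f |: (B :\ e) \in bases
}.

Section Matroid.
Variables (T : finType) (M : matroid T).

(** All bases have the same size, so the maximum is that common size. *)
Definition rank : nat := \max_(B in bases M) #|B|.

Definition indep (S : {set T}) : bool := [exists B in bases M, S \subset B].

Section Contraction.
Variable S : {S : {set T} | indep S}.

Definition contraction_bases : {set {set T}} :=
  [set B :\: val S | B in bases M & val S \subset B].

Lemma contraction_bases_neq0 : contraction_bases != finset.set0.
Proof.
have /existsP[B /andP[BM SB]] := valP S.
by apply/set0Pn; exists (B :\: val S); apply/imsetP; exists B => //; rewrite inE BM.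
Qed.

Lemma contraction_bases_ground B :
  B \in contraction_bases -> B \subset ground M :\: val S.
Proof.
by case/imsetP=> C; rewrite inE => /andP[CM _] ->; exact/finset.setSD/bases_ground.
Qed.

Lemma contraction_basis_exchange B B' :
  B \in contraction_bases -> B' \in contraction_bases ->
  forall e, e \in B :\: B' ->
  exists2 f, f \in B' :\: B & f |: (B :\ e) \in contraction_bases.
Proof.
case/imsetP=> C; rewrite inE => /andP[CM SC] ->.
case/imsetP=> C'; rewrite inE => /andP[C'M SC'] -> e.
rewrite !inE => /andP[] /[swap] /andP[eS eC]; rewrite eS /= => eC'.
have eCC' : e \in C :\: C' by rewrite inE eC' eC.
have [f] := basis_exchange CM C'M eCC'.
rewrite inE => /andP[fC fC'] fM.
have fS : f \notin val S by apply: contra fC; exact: (fintype.subsetP SC).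
exists f; first by rewrite !inE (negbTE fC) andbF fS fC'.
apply/imsetP; exists (f |: (C :\ e)).
  rewrite inE fM /=; apply/fintype.subsetP => x xS; rewrite !inE.
  rewrite (fintype.subsetP SC _ xS) andbT; apply/orP; right.
  by apply: contraNneq eS => <-.
apply/setP => x; rewrite !inE.
by have [->|] := eqVneq x f; rewrite ?fS //= andbCA.
Qed.

Definition matroid_contraction : matroid T :=
  Matroid contraction_bases_neq0 contraction_bases_ground contraction_basis_exchange.

End Contraction.
End Matroid.

Section Dressian.
Variables (R : realType) (T : finType) (M : matroid T).

(** Real functions on the bases are row vectors: coordinate [i] is the value
    at the basis [enum_val i]. *)
Definition basis_fun := 'rV[R]_#|bases M|.

Implicit Type nu : basis_fun.

Definition extend nu (B : {set T}) : \bar R :=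
  if [pick i : 'I_#|bases M| | enum_val i == B] is Some i
  then (nu ord0 i)%:E else +oo%E.

Definition rsets : {set {set T}} :=
  [set B : {set T} | (B \subset ground M) && (#|B| == rank M)].

Definition is_valuation nu : Prop :=
  forall B B', B \in rsets -> B' \in rsets -> forall e, e \in B :\: B' ->
  exists2 f, f \in B' :\: B &
    (extend nu (f |: (B :\ e)) + extend nu ((e |: B') :\ f)
       <= extend nu B + extend nu B')%E.

Definition dressian : set basis_fun := [set nu | is_valuation nu]%classic.

(** The pairs [ab] and [cd] are ordered here; the equation in [comb_type] is
    invariant under exchanging a with b or c with d.  The condition
    [#|A| + 2 = rank] (no truncated subtraction) leaves no triples in rank
    less than 2. *)
Definition triples : {set {set T} * (T * T) * (T * T)} :=
  [set z : {set T} * (T * T) * (T * T) |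
    let: (A, (a, b), (c, d)) := z in
    [&& A \subset ground M, (#|A| + 2 == rank M)%N,
        uniq [:: a; b; c; d] &
        all (fun x => x \in ground M :\: A) [:: a; b; c; d]]].

Definition comb_type nu : {set {set T} * (T * T) * (T * T)} :=
  [set z in triples |
    let: (A, (a, b), (c, d)) := z in
    (extend nu (A :|: [set a; c]) + extend nu (A :|: [set b; d]) ==
     extend nu (A :|: [set a; d]) + extend nu (A :|: [set b; c]))%E].

Definition comb_equiv nu nu' : Prop :=
  [/\ is_valuation nu, is_valuation nu' & comb_type nu = comb_type nu'].

Definition comb_class nu : set basis_fun :=
  [set nu' | comb_equiv nu' nu]%classic.

Definition dressian_fan : set (set basis_fun) :=
  [set closure (comb_class nu) | nu in dressian]%classic.

End Dressian.

Arguments dressian R {T} M.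
Arguments dressian_fan R {T} M.

Definition affinely_independent (R : realType) (m k : nat)
    (x : 'I_k.+1 -> 'rV[R]_m) : bool :=
  free [seq x (lift ord0 i) - x ord0 | i : 'I_k].

(** The dimension of the affine hull of [A]: the largest [k] such that [A]
    contains [k + 1] affinely independent points (0 if [A] is empty). *)
Definition affine_dim (R : realType) (m : nat) (A : set 'rV[R]_m) : nat :=
  \max_(k < m.+1 | `[< exists x : 'I_k.+1 -> 'rV[R]_m,
                        (forall i, A (x i)) /\ affinely_independent x >]) k.

(** The affine dimension of a set in R^m is at most m, which bounds the
    maximum over the cells. *)
Definition fan_dim (R : realType) (T : finType) (M : matroid T) : nat :=
  \max_(k < #|bases M|.+1 | `[< exists2 C : set (basis_fun R M),
      dressian_fan R M C & affine_dim C = k >]) k.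

(* Main.v *)
(** Shearer's argument for dimensions. Take affinely independent points
    x_0, ..., x_d in a cell of maximal dimension d, and d linearly independent
    columns J of the matrix with rows x_i - x_0; these columns are bases of M.
    Restricting functions to the bases containing an independent set S maps the
    cell of nu into the cell of the induced valuation of M/S, by continuity of
    the restriction, so at most dim D(M/S) elements of J contain S. Summing
    over the sets S of size r - t, each element of J is counted C(r, r - t)
    times, and there are at most C(n, r - t) sets S. *)
Require Import Defs.
From mathcomp Require Import all_boot all_order all_algebra.
From mathcomp Require Import all_classical all_reals all_analysis.
From mathcomp Require Import ring.

Set Implicit Arguments.
Unset Strict Implicit.
Unset Printing Implicit Defensive.

Import Order.TTheory GRing.Theory Num.Theory.
Import numFieldNormedType.Exports.

Local Open Scope ring_scope.

(** * Affine dimension, matrix rank and selection of columns *)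

Section AffineDimension.
Variable R : realType.

Lemma free_row_free (m k : nat) (v : 'I_k -> 'rV[R]_m) :
  free [seq v i | i : 'I_k] = row_free (\matrix_i v i).
Proof.
have E (u : 'rV_k) : u *m (\matrix_i v i)
    = \sum_(i < k) u 0 i *: (mktuple v)`_i.
  rewrite mulmx_sum_row; apply: eq_bigr => i _.
  by rewrite rowK -tnth_nth tnth_mktuple.
apply/(@freeP _ _ _ (mktuple v))/idP => [H|/row_free_inj inj c c0 i].
  apply: inj_row_free => u; rewrite E => /H u0.
  by apply/rowP => i; rewrite mxE u0.
have : (\row_i c i) = 0 :> 'rV[R]_k.
  apply: inj; rewrite mul0mx E -[RHS]c0.
  by apply: eq_bigr => j _; rewrite mxE.
by move/rowP/(_ i); rewrite !mxE.
Qed.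

Definition difference_mx (m k : nat) (x : 'I_k.+1 -> 'rV[R]_m) : 'M[R]_(k, m) :=
  \matrix_i (x (lift ord0 i) - x ord0).

(** Keep [x ord0] together with the points whose difference rows form a maximal independent family;
    these points of [A] are affinely independent. *)
Lemma rank_le_affine_dim (m k : nat) (A : set 'rV[R]_m)
    (x : 'I_k.+1 -> 'rV[R]_m) :
  (forall i, A (x i)) -> (\rank (difference_mx x) <= affine_dim A)%N.
Proof.
move=> Ax; set D := difference_mx x; set f := maxrankfun D.
pose y (i : 'I_(\rank D).+1) :=
  if unlift ord0 i is Some j then x (lift ord0 (f j)) else x ord0.
have lt_m : (\rank D < m.+1)%N by rewrite ltnS rank_leq_col.
rewrite /affine_dim.
apply: (@leq_bigmax_cond _ _ _ (Ordinal lt_m)).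
apply/asboolP; exists y; split=> [i|]; first by rewrite /y; case: unlift.
rewrite /affinely_independent free_row_free.
suff -> : \matrix_i (y (lift ord0 i) - y ord0) = rowsub f D by exact: maxrowsub_free.
by apply/matrixP => i j; rewrite !mxE /y liftK unlift_none.
Qed.

Lemma affine_dim_le (m : nat) (A : set 'rV[R]_m) : (affine_dim A <= m)%N.
Proof. by apply/bigmax_leqP => k _; rewrite -ltnS. Qed.

Lemma affine_dim_witness (m : nat) (A : set 'rV[R]_m) :
  (0 < affine_dim A)%N ->
  exists x : 'I_(affine_dim A).+1 -> 'rV[R]_m,
    (forall i, A (x i)) /\ row_free (difference_mx x).
Proof.
pose P k := exists x : 'I_k.+1 -> 'rV[R]_m,
    (forall i, A (x i)) /\ row_free (difference_mx x).
(* The disjunction passes through the maximum. Its first case covers the default value 0, where [A]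
   may be empty and have no witness; positivity excludes it. *)
suff H : affine_dim A = 0%N \/ P (affine_dim A) by case: H => [->|].
rewrite [X in P X]/affine_dim [X in X = _]/affine_dim.
elim/big_ind: _ => [|a b Ha Hb|k /asboolP[x [Ax]]]; first by left.
  by rewrite /maxn; case: ifP.
by rewrite /affinely_independent free_row_free; right; exists x.
Qed.

(** Selecting coordinates does not increase the sup distance, so a ball around [x] is mapped into
    the ball of the same radius around [colsub g x]. *)
Lemma closure_colsub (m p : nat) (g : 'I_p -> 'I_m) (A : set 'rV[R]_m)
    (B : set 'rV[R]_p) (x : 'rV[R]_m) :
  (forall y, A y -> B (colsub g y)) -> closure A x -> closure B (colsub g x).
Proof.
move=> AB Ax U /nbhs_ballP[e /= e0 Ue].
have [y [Ay xy]] := Ax _ (nbhsx_ballx x e e0).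
exists (colsub g y); split; first exact: AB.
apply: Ue; case: xy => e1 xy; split=> // i j.
by rewrite !mxE; exact: xy.
Qed.

(** Take [J] to index a column basis of [D]. The columns of [J] that [g] hits stay independent and
    all occur in [colsub g D], which bounds its rank from below for every [g] at once. *)
Lemma independent_columns (k m : nat) (D : 'M[R]_(k, m)) : row_free D ->
  exists2 J : {set 'I_m}, #|J| = k &
    forall p (g : 'I_p -> 'I_m),
      (#|J :&: [set j in codom g]| <= \rank (colsub g D))%N.
Proof.
move=> Dfree.
have Dfull : row_full D^T by rewrite /row_full mxrank_tr.
set f := fullrankfun Dfull.
have f_inj : injective f by exact: fullrankfun_inj.
exists [set f i | i : 'I_k]; first by rewrite card_imset // card_ord.
move=> p g; set J := (_ :&: _).
have Jf (i : 'I_#|J|) : exists a, f a == enum_val i.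
  have := enum_valP i; rewrite inE => /andP[/imsetP[a _ ->] _].
  by exists a.
have Jg (i : 'I_#|J|) : exists b, g b == enum_val i.
  have := enum_valP i; rewrite !inE => /andP[_ /codomP[b ->]].
  by exists b.
pose fa i := xchoose (Jf i); pose ga i := xchoose (Jg i).
have faE i : f (fa i) = enum_val i by exact/eqP/(xchooseP (Jf i)).
have gaE i : g (ga i) = enum_val i by exact/eqP/(xchooseP (Jg i)).
(* The columns indexed by the intersection, as rows of the transpose: reached through [g] on the
   left, through the column basis on the right. *)
have E : rowsub ga (rowsub g D^T) = rowsub fa (rowsub f D^T).
  by apply/matrixP => i j; rewrite !mxE faE gaE.
rewrite -mxrank_tr trmx_mxsub.
apply: leq_trans (mxrankS (rowsub_sub ga _)); rewrite E.
suff /eqP -> : row_free (rowsub fa (rowsub f D^T)) by [].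
have fa_inj : injective fa.
  by move=> i j eq_ij; apply: enum_val_inj; rewrite -!faE eq_ij.
have Y := fullrowsub_free Dfull.
have P : rowsub fa (rowsub f D^T) = rowsub fa 1%:M *m rowsub f D^T.
  by rewrite mul_rowsub_mx mul1mx.
rewrite P /row_free mxrankMfree //.
(* The right inverse of the selection matrix is its transpose, because [fa] is injective. *)
apply/row_freeP; exists (colsub fa 1%:M).
by apply/matrixP => i j; rewrite mulmx_colsub mulmx1 !mxE (inj_eq fa_inj).
Qed.

End AffineDimension.

(** * Bases and the functions on them *)

Lemma subset_setDUK (T : finType) (A B : {set T}) :
  A \subset B -> (B :\: A) :|: A = B.
Proof.
move=> sAB; apply/setP => x; rewrite !inE.
by case: (boolP (x \in A)) => [/(fintype.subsetP sAB) ->|_] //=; rewrite orbF.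
Qed.

Section Bases.
Variables (R : realType) (T : finType) (M : matroid T).

(** Induction on the size of [B :\: B']: an exchange keeps the size of [B] and moves it closer to
    [B']. Once [B] lies inside [B'], the reverse exchange would need an element of the empty set, so
    the two are equal. *)
Lemma card_bases_eq B B' : B \in bases M -> B' \in bases M -> #|B| = #|B'|.
Proof.
move=> + B'M; have [k le_k] := ubnP #|B :\: B'|.
elim: k B le_k => // k IH B le_k BM.
have [BB'|[e eBB']] := set_0Vmem (B :\: B').
  have sBB' : B \subset B' by rewrite -finset.setD_eq0 BB'.
  have [B'B|[e eB'B]] := set_0Vmem (B' :\: B).
    by apply/eqP; rewrite eqn_leq !subset_leq_card // -finset.setD_eq0 B'B.
  by have [f] := basis_exchange B'M BM eB'B; rewrite BB' inE.
have [f fB'B fM] := basis_exchange BM B'M eBB'.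
move: (eBB') (fB'B); rewrite !inE => /andP[eB' eB] /andP[fB fB'].
rewrite -(IH _ _ fM).
  by rewrite cardsU1 !inE (negbTE fB) andbF [LHS](cardsD1 e) eB.
rewrite -ltnS; apply: leq_trans le_k; rewrite ltnS [X in (_ < X)%N](cardsD1 e) eBB' ltnS.
apply/subset_leq_card/fintype.subsetP => x; rewrite !inE.
have [->|_ /=] := eqVneq x f; first by rewrite fB'.
by case/and3P=> -> -> ->.
Qed.

Lemma card_basis B : B \in bases M -> #|B| = rank M.
Proof.
move=> BM; apply/eqP; rewrite eqn_leq /rank leq_bigmax_cond //=.
by apply/bigmax_leqP => C CM; rewrite (card_bases_eq CM BM).
Qed.

Lemma extend_enum_val (nu : basis_fun R M) i :
  extend nu (enum_val i) = (nu ord0 i)%:E.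
Proof.
rewrite /extend; case: pickP => [j /eqP/enum_val_inj -> //|/(_ i)].
by rewrite eqxx.
Qed.

Lemma extend_notin (nu : basis_fun R M) B : B \notin bases M -> extend nu B = +oo%E.
Proof.
move=> BM; rewrite /extend; case: pickP => // i /eqP iB.
by rewrite -iB enum_valP in BM.
Qed.

End Bases.

(** * Restriction of valuations to a contraction *)

Section Restriction.
Variables (R : realType) (T : finType) (M : matroid T).
Variable S : {S : {set T} | indep M S}.
Let MS := matroid_contraction S.

Lemma mem_contraction (B : {set T}) : [disjoint B & val S] ->
  (B \in bases MS) = (B :|: val S \in bases M).
Proof.
move=> dBS; apply/imsetP/idP => [[C]|BSM].
  by rewrite inE => /andP[CM SC] ->; rewrite subset_setDUK.
exists (B :|: val S); first by rewrite inE BSM finset.subsetUr.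
by rewrite finset.setDUl finset.setDv finset.setU0; apply/esym/finset.setDidPl.
Qed.

Lemma disjoint_contraction (B : {set T}) : B \in bases MS -> [disjoint B & val S].
Proof.
case/imsetP=> C _ ->.
by rewrite -setI_eq0 finset.setIDAC finset.setDIl finset.setDv finset.setI0.
Qed.

Lemma lift_basis (i : 'I_#|bases MS|) : enum_val i :|: val S \in bases M.
Proof. by rewrite -mem_contraction ?enum_valP // disjoint_contraction ?enum_valP. Qed.

(** Embeds the coordinates for M/S into those for M, so that restricting a function becomes a
    selection of columns. *)
Definition lift_index (i : 'I_#|bases MS|) : 'I_#|bases M| :=
  enum_rank_in (lift_basis i) (enum_val i :|: val S).

Lemma enum_val_lift_index i : enum_val (lift_index i) = enum_val i :|: val S.
Proof. by rewrite enum_rankK_in ?lift_basis. Qed.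

Lemma codom_lift_index j : (j \in codom lift_index) = (val S \subset enum_val j).
Proof.
apply/codomP/idP => [[i ->]|Sj].
  by rewrite enum_val_lift_index finset.subsetUr.
have BMS : enum_val j :\: val S \in bases MS.
  by apply/imsetP; exists (enum_val j); rewrite // inE enum_valP.
exists (enum_rank_in BMS (enum_val j :\: val S)); apply: enum_val_inj.
by rewrite enum_val_lift_index enum_rankK_in // subset_setDUK.
Qed.

Definition restrict (nu : basis_fun R M) : basis_fun R MS := colsub lift_index nu.

(** Adding S preserves and reflects being a basis, so the infinite values agree as well as the
    finite ones. *)
Lemma extend_restrict nu (B : {set T}) : [disjoint B & val S] ->
  extend (restrict nu) B = extend nu (B :|: val S).
Proof.
move=> dBS; have [BMS|BMS] := boolP (B \in bases MS).
  rewrite -{1}(enum_rankK_in BMS BMS) extend_enum_val mxE -extend_enum_val.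
  by rewrite enum_val_lift_index enum_rankK_in.
by rewrite !extend_notin // -mem_contraction.
Qed.

Lemma indep_ground : val S \subset ground M.
Proof.
have /existsP[B /andP[BM SB]] := valP S.
exact: fintype.subset_trans SB (bases_ground BM).
Qed.

Lemma rank_contraction : (rank MS + #|val S|)%N = rank M.
Proof.
have /set0Pn[B BMS] := bases_neq0 MS.
rewrite -(card_basis BMS).
have dBS := disjoint_contraction BMS.
rewrite -(card_basis (B := B :|: val S)) -?mem_contraction //.
by apply/esym/eqP; rewrite (leq_card_setU B (val S)).2.
Qed.

Lemma rsets_contraction (B : {set T}) : B \in rsets MS ->
  [disjoint B & val S] /\ B :|: val S \in rsets M.
Proof.
rewrite !inE subsetD => /andP[/andP[BM dBS] /eqP cB]; split=> //.
rewrite finset.subUset BM indep_ground -rank_contraction -cB /=.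
by rewrite (leq_card_setU B (val S)).2.
Qed.

(** Apply the exchange inequality of M to [B :|: val S] and [B' :|: val S]: S cancels from the set
    differences, so the elements exchanged lie outside S. *)
Lemma valuation_restrict nu : is_valuation nu -> is_valuation (restrict nu).
Proof.
move=> nuP B B' /rsets_contraction[dB rB] /rsets_contraction[dB' rB'] e eBB'.
move: (eBB'); rewrite inE => /andP[eB' eB].
have eS : e \notin val S by rewrite (disjointFr dB).
have [|f] := nuP _ _ rB rB' e; first by rewrite !inE negb_or eB' eS eB.
rewrite !inE negb_or => /andP[/andP[fB fS]]; rewrite (negbTE fS) orbF => fB' H.
exists f; first by rewrite inE fB fB'.
have dis (A : {set T}) x y : x \notin val S -> [disjoint A & val S] ->
    [disjoint (x |: A) :\ y & val S].
  move=> xS dA; apply: disjointWl (finset.subD1set _ _) _.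
  by rewrite finset.disjoints_subset finset.subUset finset.sub1set inE xS -finset.disjoints_subset.
have dis' (A : {set T}) x y : x \notin val S -> [disjoint A & val S] ->
    [disjoint x |: (A :\ y) & val S].
  move=> xS dA.
  rewrite finset.disjoints_subset finset.subUset finset.sub1set inE xS -finset.disjoints_subset.
  exact: disjointWl (finset.subD1set _ _) dA.
rewrite !extend_restrict ?dis ?dis' //.
congr (_ + _ <= _)%E: H; congr extend; apply/setP => x; rewrite !inE.
  by have [->|] := eqVneq x e; rewrite ?(negbTE eS) ?orbF // orbA.
by have [->|] := eqVneq x f; rewrite ?(negbTE fS) ?orbF // orbA.
Qed.

(** The equation of the restricted function at (A, ab, cd) is that of the original function at (A
    :|: S, ab, cd), which is a triple of M by the rank formula. *)
Lemma comb_type_restrict nu nu' :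
  comb_type nu = comb_type nu' -> comb_type (restrict nu) = comb_type (restrict nu').
Proof.
move=> E; apply/setP => -[[A [a b]] [c d]]; rewrite [LHS]inE [RHS]inE.
case: (boolP (_ \in triples _)) => //=; rewrite inE => /and4P[].
rewrite subsetD => /andP[AM dAS] rA u /and5P[+ + + + _].
have memMS x : x \in ground MS :\: A ->
    [/\ x \notin A, x \notin val S & x \in ground M].
  by rewrite inE [ground _]/= inE => /and3P.
move=> /memMS[aA aS aM] /memMS[bA bS bM] /memMS[cA cS cM] /memMS[dA dS dM].
have dis x y : x \notin val S -> y \notin val S -> [disjoint A :|: [set x; y] & val S].
  move=> xS yS; rewrite finset.disjoints_subset !finset.subUset !finset.sub1set !inE xS yS.
  by rewrite -finset.disjoints_subset dAS.
have key : (A :|: val S, (a, b), (c, d)) \in triples M.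
  rewrite inE u /= !inE !negb_or aA aS aM bA bS bM cA cS cM dA dS dM.
  rewrite finset.subUset AM indep_ground -rank_contraction.
  have /eqP -> : #|A :|: val S| == (#|A| + #|val S|)%N by rewrite (leq_card_setU _ _).2.
  by rewrite -(eqP rA) addnAC eqxx.
have := congr1 (fun Z : {set _} => (A :|: val S, (a, b), (c, d)) \in Z) E.
rewrite /comb_type [LHS]inE [RHS]inE key /=.
by rewrite !extend_restrict ?dis // ![A :|: _ :|: val S]finset.setUAC.
Qed.

Lemma comb_class_restrict nu nu' :
  comb_class nu nu' -> comb_class (restrict nu) (restrict nu').
Proof.
by case=> v v' E; split; [exact: valuation_restrict..|exact: comb_type_restrict].
Qed.

End Restriction.

(** * Dimension of the fan and double counting *)

Lemma affine_dim_le_fan_dim (R : realType) (T : finType) (M : matroid T)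
    (nu : basis_fun R M) : is_valuation nu ->
  (affine_dim (closure (comb_class nu)) <= fan_dim R M)%N.
Proof.
move=> nuP; set d := affine_dim _.
have lt_d : (d < #|bases M|.+1)%N by rewrite ltnS affine_dim_le.
apply: (@leq_bigmax_cond _ _ _ (Ordinal lt_d)); apply/asboolP.
by exists (closure (comb_class nu)) => //; exists nu.
Qed.

Section FanDimension.
Variables (R : realType) (T : finType) (M : matroid T).

(** Count the pairs of a [k]-set and a basis of [J] containing it in both orders. *)
Lemma card_subsets_of_bases (J : {set 'I_#|bases M|}) (k : nat) :
  \sum_(A : {set T} | (A \subset ground M) && (#|A| == k))
     #|[set j in J | A \subset enum_val j]| = (#|J| * 'C(rank M, k))%N.
Proof.
under eq_bigr do rewrite -sum1_card big_mkcond /=.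
rewrite exchange_big /= -sum_nat_const [RHS]big_mkcond /=.
apply: eq_bigr => j _.
rewrite -big_mkcondr /=; case: (boolP (j \in J)) => jJ; last first.
  by rewrite big1 // => A; rewrite inE (negbTE jJ) andbF.
rewrite -(card_basis (enum_valP j)) -cards_draws -sum1_card.
apply: eq_bigl => A; rewrite !inE jJ /= andbC.
case: (boolP (A \subset enum_val j)) => //= Aj.
by rewrite (fintype.subset_trans Aj) // bases_ground ?enum_valP.
Qed.

Lemma affine_dim_shearer (nu : basis_fun R M) (k c : nat) :
  is_valuation nu ->
  (forall S : {S : {set T} | indep M S}, #|val S| == k ->
     fan_dim R (matroid_contraction S) <= c)%N ->
  (affine_dim (closure (comb_class nu)) * 'C(rank M, k) <= 'C(#|ground M|, k) * c)%N.
Proof.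
move=> nuP Hc; set d := affine_dim _.
have [->|d_gt0] := posnP d; first by rewrite mul0n.
have [x [xC /independent_columns[J cJ HJ]]] := affine_dim_witness d_gt0.
rewrite -/d in x xC J cJ HJ; rewrite -{1}cJ -card_subsets_of_bases.
rewrite -cards_draws -sum_nat_const.
rewrite [X in (_ <= X)%N](eq_bigl (fun A : {set T} => (A \subset ground M) && (#|A| == k)));
  last by move=> A; rewrite inE.
apply: leq_sum => A /andP[_ cA].
(* A dependent set lies in no basis and contributes 0, so only contractions by independent sets
   matter. *)
have [indA|/negP nindA] := boolP (indep M A); last first.
  rewrite (_ : [set _ in _ | _] = finset.set0) ?cards0 //.
  apply/setP => j; rewrite !inE; apply: contra_notF nindA => /andP[_ Aj].
  by apply/existsP; exists (enum_val j); rewrite enum_valP.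
pose S : {S : {set T} | indep M S} := exist _ A indA.
apply: leq_trans (Hc S cA).
apply: leq_trans (affine_dim_le_fan_dim (valuation_restrict (S := S) nuP)).
have -> : [set j in J | A \subset enum_val j] = J :&: [set j in codom (@lift_index _ _ S)].
  by apply/setP => j; rewrite !inE codom_lift_index.
apply: leq_trans (HJ _ _) _.
(* Restriction is linear: the selected columns are the difference matrix of the restricted points,
   whose rank is bounded by the dimension of their cell. *)
have -> : colsub (@lift_index _ _ S) (difference_mx x)
    = difference_mx (fun i => restrict S (x i)).
  by apply/matrixP => i j; rewrite !mxE.
apply: rank_le_affine_dim => i.
by apply: closure_colsub (xC i); exact: comb_class_restrict.
Qed.

Lemma fan_dim_shearer (k c : nat) :
  (forall S : {S : {set T} | indep M S}, #|val S| == k ->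
     fan_dim R (matroid_contraction S) <= c)%N ->
  (fan_dim R M * 'C(rank M, k) <= 'C(#|ground M|, k) * c)%N.
Proof.
move=> Hc; rewrite {1}/fan_dim; elim/big_ind: _ => [|a b Ha Hb|d].
- by rewrite mul0n.
- by rewrite /maxn; case: ifP.
by move=> /asboolP[C [nu nuP <-] <-]; exact: affine_dim_shearer.
Qed.

End FanDimension.

(** * Binomial identity and conclusion *)

Lemma rank_le_ground (T : finType) (M : matroid T) : (rank M <= #|ground M|)%N.
Proof. by apply/bigmax_leqP => B /bases_ground/subset_leq_card. Qed.

(** Both sides count pairs of an (r-t)-set inside an r-set. Algebraically, each becomes n! after
    multiplication by (n-r)! (r-t)! t!. *)
Lemma mul_bin_subset (n r t : nat) : (t <= r)%N -> (r <= n)%N ->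
  ('C(n, r) * 'C(r, r - t) = 'C(n, r - t) * 'C(n - r + t, t))%N.
Proof.
move=> tr rn; have nE : (n - (r - t) = n - r + t)%N by rewrite subnBA // addnBAC.
have le1 : (r - t <= n)%N := leq_trans (leq_subr _ _) rn.
apply/eqP; rewrite -(eqn_pmul2r (fact_gt0 (n - r))) -(eqn_pmul2r (fact_gt0 (r - t))).
rewrite -(eqn_pmul2r (fact_gt0 t)); apply/eqP.
have E1 := bin_fact rn; have E2 := bin_fact (leq_subr t r).
have E3 := bin_fact le1; have E4 := bin_fact (leq_addl (n - r) t).
rewrite subKn // in E2; rewrite nE in E3; rewrite addnK in E4.
transitivity n`!; first by rewrite -E1 -E2; ring.
by rewrite -E3 -E4; ring.
Qed.

Theorem theorem4 (R : realType) (T : finType) (M : matroid T) (r n t : nat)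
    (hr : rank M = r) (hn : #|ground M| = n) (ht : (t <= r)%N) :
  (fan_dim R M)%:R / ('C(n, r))%:R <=
  (\max_(S : {S : {set T} | indep M S} | #|val S| == (r - t)%N)
      fan_dim R (matroid_contraction S))%:R / ('C(n - r + t, t))%:R :> rat.
Proof.
have rn : (r <= n)%N by rewrite -hr -hn rank_le_ground.
set c := \max_(S | _) _.
have H : (fan_dim R M * 'C(r, r - t) <= 'C(n, r - t) * c)%N.
  rewrite -hr -hn; apply: fan_dim_shearer => S cS.
  by apply: leq_bigmax_cond; rewrite -hr.
have gt1 : (0 < 'C(n, r))%N by rewrite bin_gt0.
have gt2 : (0 < 'C(n - r + t, t))%N by rewrite bin_gt0 leq_addl.
have gt3 : (0 < 'C(r, r - t))%N by rewrite bin_gt0 leq_subr.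
rewrite ler_pdivrMr ?ltr0n // mulrAC ler_pdivlMr ?ltr0n // -!natrM ler_nat.
(* The factor ['C(r, r - t)] lets the identity produce ['C(n - r + t, t)] on the right; cancelling
   it from both sides leaves [H]. *)
rewrite -(leq_pmul2r gt3) mulnAC -[X in (_ <= X)%N]mulnA mul_bin_subset //.
by rewrite !mulnA leq_pmul2r // [(c * _)%N]mulnC.
Qed.
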